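(* Let $a>0$ and $f>6$ be real numbers, and let $x_0$ be the real solution of the equation $\frac{x}{\frac{9}{4}(2+a)\ln x}=3$ such that $x_0\ge 3$. For integers $n\ge\lceil x_0\rceil$, let $n$ sensors with common sensing radius $r=\frac{f}{2n}$ be placed independently and uniformly at random on the unit interval $[0,1]$. Then the total expected movement to the power $a$ of the sensors required to cover the interval $[0,1]$ is in $$O\left(\frac{1}{n^{\frac{a}{2}-1}}\left(\frac{\ln n}{n}\right)^{\frac{a}{2}}\right).$$
   Context: A sensor with radius $r$ located at position $y$ covers the points at distance at most $r$ from $y$, i.e. $[y-r,y+r]$. If the initial (random) sensor positions are $U_1,\dots,U_n$ and the sensors are moved to final positions $b_1,\dots,b_n$ on the line, coverage is attained when $[0,1]\subseteq\bigcup_{i=1}^n[b_i-r,b_i+r]$, and the total movement to the power $a$ is $\sum_{i=1}^n|U_i-b_i|^a$ (a sensor that is not moved contributes $0$). The total expected movement to the power $a$ required to cover the interval is the expectation, over the random initial positions, of the minimum of $\sum_{i=1}^n|U_i-b_i|^a$ over all choices of final positions $b_1,\dots,b_n$ (allowed to depend on the initial positions) attaining coverage; the claim is an upper bound on it. The implied constant in $O(\cdot)$ may depend on $a$ and $f$ but not on $n$. *)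

(* Defs.v *)
From HB Require Import structures.
From mathcomp Require Export all_boot all_order all_algebra.
From mathcomp Require Export all_classical all_reals all_analysis.
Export Order.TTheory GRing.Theory Num.Theory numFieldNormedType.Exports.

Set Implicit Arguments.
Unset Strict Implicit.
Unset Printing Implicit Defensive.

Local Open Scope classical_set_scope.
Local Open Scope ring_scope.

Section sensors.
Context {R : realType} {n : nat}.
Implicit Types (r a : R) (u b : 'I_n -> R).

Definition attains_coverage r b : Prop :=
  `[0, 1]%classic `<=` \bigcup_(i in [set: 'I_n]) `[b i - r, b i + r]%classic.

(* For a != 0 a sensor that stays in place contributes 0 `^ a = 0. *)
Definition total_movement a u b : R := \sum_(i < n) `|u i - b i| `^ a.

(* For a > 0 the infimum is attained as soon as coverage is possible; it is +oo
   when no placement of n sensors of radius r covers [0, 1]. *)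
Definition min_movement r a u : \bar R :=
  ereal_inf [set (total_movement a u b)%:E | b in [set b | attains_coverage r b]].

End sensors.

Section random_placement.
Context {d : measure_display} {T : measurableType d} {R : realType}.
Context (P : probability T R) {n : nat}.
Implicit Type U : 'I_n -> {RV P >-> R}.

Definition mutually_independent U : Prop :=
  forall (J : {set 'I_n}) (A : 'I_n -> set R),
    (forall i, measurable (A i)) ->
    P (\bigcap_(i in [set` J]) (U i @^-1` A i)) =
      (\prod_(i in J) P (U i @^-1` A i))%E.

Definition uniform01 (X : {RV P >-> R}) : Prop :=
  forall A : set R, measurable A -> distribution P X A = uniform_prob (@ltr01 R) A.

(* For a > 0 the integrand is an infimum of continuous functions of the initial
   positions, hence upper semicontinuous in them and measurable, so that this
   nonnegative integral is an expectation. *)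
Definition expected_movement r a U : \bar R :=
  (\int[P]_w min_movement r a (fun i => U i w))%E.

End random_placement.

(* Main.v *)
Require Import Defs.
From mathcomp Require Import measurable_realfun zify ring lra.
Local Open Scope ring_scope.

(** The bound holds even without the factor (ln n)^(a/2). Let h be n/12 rounded up
    and cut [0, 1] into 2h cells; as f > 6, a sensor at the centre of a cell covers
    it. The first half of the sensors serves the h cells of [0, 1/2], the other
    half serves those of [1/2, 1]; the two tasks are exchanged by x |-> 1 - x.
    Going through the cells of [0, 1/2] from left to right, let each cell take the
    leftmost unused sensor that is not to its left. If cell j finds no sensor among
    the cells j, ..., j+k-1, then for some l <= j the window of cells
    j-l, ..., j+k-1 contains at most l sensors: follow the current busy period back
    to its start. The window has l+k cells and at least 3(l+k)/2 expected sensors,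
    so a Chernoff bound makes this event exponentially unlikely in l+k. Hence the
    displacement of the sensor for cell j, in units of the cell length, has an
    exponential tail, and each of the h <= n moved sensors costs O(n^-a) in
    expectation. *)

(** * Greedy matching of cells to sensors *)

Section greedy.
Context {R : realType} {I : finType}.
Implicit Types (v : I -> R) (J : {set I}) (c : nat -> R).

Definition window v J c (x y : nat) : {set I} :=
  [set i in J | (c x <= v i) && (v i < c y)].

Definition plentiful v J c (j k : nat) : bool :=
  [forall l : 'I_j.+1, l < #|window v J c (j - l) (j + k)|]%N.

Lemma greedy_matching v J c (i0 : I) (D : nat -> nat) (h : nat) :
  {homo c : x y / (x <= y)%N >-> x <= y} ->
  (forall j, (j < h)%N -> plentiful v J c j (D j)) ->
  exists s : nat -> I, [/\ {in [pred j | (j < h)%N] &, injective s},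
    forall j, (j < h)%N -> s j \in window v J c j (j + D j) &
    forall j y, (j < h)%N -> y \in J -> c j <= v y ->
      (forall i, (i < h)%N -> s i != y) -> v (s j) <= v y].
Proof.
move=> cmono; elim: h => [|h IH] hD; first by exists (fun=> i0); split.
have [|s [sinj swin sleft]] := IH; first by move=> j jh; apply: hD; lia.
pose free := [pred y | [&& y \in window v J c h (h + D h) &
  [forall i : 'I_h, s i != y]]].
have [y0 y0f|nofree] := pickP free; last first.
  exfalso.
  (* [full j]: all sensors from [c j] to the end of the window of cell [h] are taken. The least such
     [j] starts the busy period. *)
  pose full j := (j <= h)%N && [forall y in window v J c j (h + D h),
    [exists i : 'I_h, s i == y]].
  have fullh : exists j, full j.
    exists h; rewrite /full leqnn/=; apply/forall_inP => y yw.
    by have /negbT := nofree y; rewrite inE/= yw/= => /forallPn[i]; rewrite negbK => ?;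
      apply/existsP; exists i.
  have [j /andP[jh /forall_inP jfull] jmin] := ex_minnP fullh.
  have sub : window v J c j (h + D h) \subset
      (fun i : 'I_h => s i) @: [pred i : 'I_h | (j <= i)%N].
    apply/fintype.subsetP => y yw; have /existsP[i /eqP siy] := jfull _ yw.
    apply/imsetP; exists i => //; rewrite inE leqNgt; apply/negP => ij.
    suff : full i by move/jmin; lia.
    apply/andP; split; first by lia.
    apply/forall_inP => z; rewrite inE => /and3P[zJ ciz zlt].
    apply: contraT => /existsPn zfree.
    have zy : v (s i) <= v z.
      apply: sleft => // [i' i'h]; exact: (zfree (Ordinal i'h)).
    have cjz : c j <= v z.
      move: yw; rewrite inE => /and3P[_ + _]; rewrite -siy => /le_trans; exact.
    have zw : z \in window v J c j (h + D h) by rewrite inE zJ cjz.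
    by have /existsP[i' /eqP i'z] := jfull _ zw; have := zfree i'; rewrite i'z eqxx.
  (* Plenty at [h] with [l = h - j] asks for more than [h - j] sensors, but only the cells
     [j, ..., h - 1] took them. *)
  have := hD h (ltnSn h); move=> /forallP/(_ (inord (h - j))).
  rewrite inordK; last by lia.
  rewrite subKn// ltnNge => /negP; apply.
  apply: (leq_trans (subset_leq_card sub)); apply: (leq_trans (leq_imset_card _ _)).
  rewrite -[leqRHS]card_ord.
  have fP (i : 'I_h) : (j <= i)%N -> (i - j < h - j)%N by have := ltn_ord i; lia.
  (* The shift by [j] below needs a default value in ['I_(h - j)], so the empty range is treated
     apart. *)
  case: (posnP (h - j)) => hj0.
    rewrite eq_card0 // => i; rewrite !inE; have := ltn_ord i; lia.
  pose f (i : 'I_h) : 'I_(h - j) := odflt (Ordinal hj0) (insub (i - j)%N).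
  rewrite -(@card_in_imset _ _ f); last first.
    move=> i i'; rewrite !inE => ji ji' /(congr1 val).
    by rewrite /f !insubT ?fP//= => _ _ iE; apply: ord_inj; lia.
  exact: max_card.
have [y yf ymin] := @arg_minP _ _ _ y0 free v y0f.
move: (yf); rewrite inE/= => /andP[yw /forallP yfree].
have {}yfree i : (i < h)%N -> s i != y by move=> ih; exact: (yfree (Ordinal ih)).
exists (fun j => if (j < h)%N then s j else y); split.
- move=> i j; rewrite !inE => ih jh; case: ltnP => ih'; case: ltnP => jh'.
  + by move/sinj; apply.
  + by move=> e; have := yfree _ ih'; rewrite e eqxx.
  + by move=> e; have := yfree _ jh'; rewrite e eqxx.
  + by move=> _; lia.
- move=> j; case: (ltnP j h) => [jh _|hj jh]; first exact: swin.
  by have -> : j = h by lia.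
- move=> j z jh zJ cjz zfree; case: (ltnP j h) => jh'.
    apply: sleft => // i ih; have := zfree i; rewrite ih; apply; lia.
  have jE : j = h by lia.
  subst j; have := yw; rewrite inE => /and3P[_ _ yc].
  (* A free sensor beyond the window lies right of [y]; one inside it competed for the minimum. *)
  have [zc|zc] := leP (c (h + D h)%N) (v z); first exact: (le_trans (ltW yc)).
  apply: ymin; rewrite inE/= inE zJ cjz zc/=; apply/forallP => i.
  by have := zfree i; rewrite ltn_ord; apply; have := ltn_ord i; lia.
Qed.

End greedy.

(** * Deterministic cost of covering one half, then both by reflection *)

Lemma le_powR2r {R : realType} (a x y : R) :
  0 <= a -> 0 <= x -> x <= y -> x `^ a <= y `^ a.
Proof.
move=> a0 x0 xy; apply: ge0_ler_powR => //; rewrite nnegrE//.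
exact: le_trans xy.
Qed.

Section half.
Context {R : realType} {I : finType}.
Implicit Types (v : I -> R) (J : {set I}).

(** Sensors outside the image of [s] stay in place, at no cost because [a != 0]. *)
Lemma relocate (a : R) v J (h : nat) (s : 'I_h -> I) (p : 'I_h -> R) :
  a != 0 -> injective s -> (forall j, s j \in J) ->
  exists2 b : I -> R, (forall j, b (s j) = p j) &
    \sum_(i in J) `|v i - b i| `^ a = \sum_(j < h) `|v (s j) - p j| `^ a.
Proof.
move=> a0 sinj sJ.
pose b i := if [pick j | s j == i] is Some j then p j else v i.
have bs j : b (s j) = p j.
  rewrite /b; case: pickP => [j' /eqP/sinj-> //|/(_ j)]; by rewrite eqxx.
exists b => //.
rewrite (bigID (mem (s @: 'I_h)))/= [X in _ + X]big1 ?addr0; last first.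
  move=> i /andP[_ inot]; rewrite /b; case: pickP => [j /eqP sj|_].
    by rewrite -sj imset_f in inot.
  by rewrite subrr normr0 powR0.
rewrite (eq_bigl (mem (s @: 'I_h))); last first.
  move=> i /=; apply: andb_idl => /imsetP[j _ ->]; exact: sJ.
rewrite big_imset/=; last by move=> ? ? _ _; exact: sinj.
by apply: eq_bigr => j _; rewrite bs.
Qed.

Definition grid (h j : nat) : R := j%:R / (2 * h%:R).

Lemma le_grid h : {homo grid h : x y / (x <= y)%N >-> x <= y}.
Proof.
by move=> x y xy; rewrite /grid ler_wpM2r ?ler_nat// invr_ge0 mulr_ge0.
Qed.

Definition grid_center (h j : nat) : R := (j%:R + 1 / 2) / (2 * h%:R).

Lemma grid_center_near h (x : R) : (0 < h)%N -> 0 <= x <= 1 / 2 ->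
  exists2 j, (j < h)%N & `|x - grid_center h j| <= 1 / (4 * h%:R).
Proof.
move=> h0 /andP[x0 x1].
have hR : 0 < h%:R :> R by rewrite ltr0n.
have near j : 2 * h%:R * x - 1 <= j%:R <= 2 * h%:R * x ->
    `|x - grid_center h j| <= 1 / (4 * h%:R).
  move=> /andP[j1 j2].
  have -> : x - grid_center h j = (2 * h%:R * x - j%:R - 1 / 2) / (2 * h%:R).
    by rewrite /grid_center; field; rewrite ?gt_eqF.
  rewrite normrM [X in _ * X]gtr0_norm ?invr_gt0 ?mulr_gt0//.
  have -> : 1 / (4 * h%:R) = 1 / 2 / (2 * h%:R) :> R by field; rewrite ?gt_eqF.
  by rewrite ler_pM2r ?invr_gt0 ?mulr_gt0// ler_norml; lra.
have y0 : 0 <= 2 * h%:R * x by rewrite mulr_ge0// mulr_ge0.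
have yh : 2 * h%:R * x <= h%:R by nra.
have /andP[t1 t2] := truncn_itv y0.
move: t1 t2; set t := Num.truncn _; rewrite -natr1 => t1 t2.
have [th|ht] := ltnP t h; first by exists t => //; apply: near; lra.
(* Here [x = 1 / 2], the right end of the last cell. *)
exists h.-1; first by lia.
apply: near; rewrite -subn1 natrB//.
have : h%:R <= t%:R :> R by rewrite ler_nat.
lra.
Qed.

(* The term (k+1)/(2h) to the power a is the cost of fetching a sensor k cells away.
   The factor 2^a (k+1) makes the weight at least h for k = 2h - j, which pays for an
   arbitrary assignment when cell j finds no sensor at all. *)
Definition scarcity_weight (a : R) (h k : nat) : R :=
  2 `^ a * (k.+1%:R * (k.+1%:R / (2 * h%:R)) `^ a).

(** If [d] is the least reach at which cell [j] is plentiful, the term [k = d - 1] alone pays for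
    its sensor. Summing over all failing [k] replaces the random [d] by indicators, so that only
    tail probabilities are needed. *)
Definition scarcity_cost (a : R) v J (h : nat) : R :=
  \sum_(j < h) \sum_(k < (2 * h).+1 | (j + k <= 2 * h)%N)
    scarcity_weight a h k * (~~ plentiful v J (grid h) j k)%:R.

Lemma scarcity_weight_ge0 a h k : 0 <= scarcity_weight a h k.
Proof. by rewrite mulr_ge0 ?powR_ge0// mulr_ge0 ?powR_ge0. Qed.

Lemma le_scarcity_weight a h k : 0 < a ->
  (k.+1%:R / (2 * h%:R)) `^ a <= scarcity_weight a h k.
Proof.
move=> a0; rewrite /scarcity_weight mulrA ler_peMl ?powR_ge0//.
have p1 : 1 <= 2 `^ a :> R.
  by rewrite -[leLHS](powRr0 2); apply: ler_powR; [lra|exact: ltW].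
by rewrite mulr_ege1// ler1n.
Qed.

(** For [l = 0] the window is empty. Hence the least plentiful reach is positive and has a
    predecessor. *)
Lemma plentiful0 v J c j : ~~ plentiful v J c j 0.
Proof.
apply/forallPn; exists ord0; rewrite subn0 addn0 -leqNgt leqn0 cards_eq0.
apply/eqP/setP => i; rewrite !inE; apply/negP => /and3P[_ ci].
by rewrite ltNge ci.
Qed.

Lemma half_cover (a : R) v J (h : nat) :
  0 < a -> (0 < h)%N -> (forall i, i \in J -> 0 <= v i <= 1) ->
  (h <= #|J|)%N ->
  exists2 b : I -> R,
    (forall x, 0 <= x <= 1 / 2 ->
      exists2 i, i \in J & `|x - b i| <= 1 / (4 * h%:R)) &
    \sum_(i in J) `|v i - b i| `^ a <= scarcity_cost a v J h.
Proof.
move=> a0 h0 v01 hJ.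
have hR : 0 < h%:R :> R by rewrite ltr0n.
have h2R : 0 < 2 * h%:R :> R by rewrite mulr_gt0.
have ctr j : (j < h)%N -> grid h j <= grid_center h j <= grid h j.+1.
  move=> jh; rewrite /grid /grid_center !ler_pM2r ?invr_gt0//.
  by rewrite -(natr1 j); lra.
suff [s [sinj sJ scost]] : exists s : 'I_h -> I, [/\ injective s,
    forall j, s j \in J & \sum_(j < h) `|v (s j) - grid_center h j| `^ a <=
      scarcity_cost a v J h].
  have [|b bs bsum] := @relocate a v J h s (fun j => grid_center h j) _ sinj sJ.
    by rewrite gt_eqF.
  exists b; last by rewrite bsum.
  move=> x /(grid_center_near _ _ h0)[j jh jx].
  by exists (s (Ordinal jh)); rewrite ?bs.
have term_ge0 (j : 'I_h) : 0 <= \sum_(k < (2 * h).+1 | (j + k <= 2 * h)%N)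
    scarcity_weight a h k * (~~ plentiful v J (grid h) j k)%:R.
  by apply: sumr_ge0 => k _; rewrite mulr_ge0 ?scarcity_weight_ge0.
have term_ge (j : 'I_h) k : (j + k <= 2 * h)%N ->
    ~~ plentiful v J (grid h) j k -> scarcity_weight a h k <=
  \sum_(k < (2 * h).+1 | (j + k <= 2 * h)%N)
    scarcity_weight a h k * (~~ plentiful v J (grid h) j k)%:R.
  move=> jk np; have kh : (k < (2 * h).+1)%N by lia.
  rewrite (bigD1 (Ordinal kh))//= np mulr1 lerDl.
  by apply: sumr_ge0 => k' _; rewrite mulr_ge0 ?scarcity_weight_ge0.
(* Either every cell is plentiful with reach up to 1 and the greedy matching applies, or the weight
   of one failure pays for any assignment. *)
case: (boolP [forall j : 'I_h, plentiful v J (grid h) j (2 * h - j)]).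
  move=> /forallP enough.
  have /boolp.choice[D DP] : forall j, exists d, (j < h)%N ->
      [/\ plentiful v J (grid h) j d, (j + d <= 2 * h)%N &
         forall k, (k < d)%N -> ~~ plentiful v J (grid h) j k].
    move=> j; have [jh|] := ltnP j h; last by exists 0%N.
    have ex : exists d, plentiful v J (grid h) j d.
      by exists (2 * h - j)%N; exact: (enough (Ordinal jh)).
    have [d dP dmin] := ex_minnP ex; exists d => _; split=> //.
      have := dmin _ (enough (Ordinal jh)); rewrite /=; lia.
    by move=> k kd; apply/negP => /dmin; rewrite leqNgt kd.
  have i0 : I.
    have : (0 < #|J|)%N by exact: leq_trans hJ.
    by rewrite card_gt0 => /set0Pn/cid[i _].
  have [|s [sinj swin _]] := @greedy_matching R I v J (grid h) i0 D h (@le_grid h).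
    by move=> j /DP[].
  exists (fun j : 'I_h => s j); split.
  - by move=> i j /sinj ij; apply: ord_inj; apply: ij; rewrite inE.
  - by move=> j; have := swin _ (ltn_ord j); rewrite inE => /andP[].
  apply: ler_sum => j _; have jh := ltn_ord j.
  have [pD Dle Dmin] := DP _ jh.
  case: (posnP (D j)) => [D0|Dpos].
    by have := plentiful0 v J (grid h) j; rewrite D0 in pD; rewrite pD.
  have Dk : (D j).-1.+1 = D j by rewrite prednK.
  apply: (@le_trans _ _ (scarcity_weight a h (D j).-1)); last first.
    by apply: term_ge; [lia|apply: Dmin; lia].
  apply: (le_trans _ (le_scarcity_weight _ _ _ a0)); rewrite Dk.
  apply: le_powR2r => //; first exact: ltW.
  (* The sensor and the centre of cell [j] both lie between [grid h j] and [grid h (j + D j)]. *)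
  have := swin _ jh; rewrite inE => /and3P[_ w1 w2].
  have /andP[c1 c2] := ctr _ jh.
  have c3 : grid h j.+1 <= grid h (j + D j) :> R by apply: le_grid; lia.
  have -> : (D j)%:R / (2 * h%:R) = grid h (j + D j) - grid h j :> R.
    by rewrite /grid natrD; field; rewrite gt_eqF.
  rewrite ler_norml; lra.
move=> /forallPn[j0 scarce].
(* Any [h] sensors of [J] will do: each moves by at most 1, for a total of at most [h]. *)
pose s (j : 'I_h) : I := enum_val (widen_ord hJ j).
exists s; split.
- by move=> i j /enum_val_inj/(congr1 val)/= ij; exact: ord_inj.
- by move=> j; exact: enum_valP.
apply: (@le_trans _ _ h%:R).
  rewrite -[leRHS]mulr1 -[in leRHS](card_ord h) mulr_natl -sumr_const.
  apply: ler_sum => j _; rewrite -[leRHS](_ : 1 `^ a = 1); last by rewrite powR1.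
  apply: le_powR2r => //; first exact: ltW.
  have /andP[c1 c2] := ctr _ (ltn_ord j).
  have g0 : 0 <= grid h j by rewrite divr_ge0// ltW.
  have g1 : grid h j.+1 <= 1 :> R.
    by rewrite /grid ler_pdivrMr// mul1r -natrM ler_nat; have := ltn_ord j; lia.
  have /andP[v0 v1] := v01 _ (enum_valP (widen_ord hJ j)).
  by rewrite ler_norml; rewrite -/(s j) in v0 v1; lra.
have jh := ltn_ord j0.
apply: (@le_trans _ _ (scarcity_weight a h (2 * h - j0))); last first.
  apply: (le_trans (term_ge _ _ _ scarce)); first by lia.
  by rewrite /scarcity_cost (bigD1 j0)//= lerDl; apply: sumr_ge0.
rewrite /scarcity_weight mulrCA -powRM//.
have big : 1 <= 2 * ((2 * h - j0).+1%:R / (2 * h%:R)) :> R.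
  rewrite mulrA ler_pdivlMr// mul1r -!natrM ler_nat; lia.
apply: (@le_trans _ _ ((2 * h - j0).+1%:R)); first by rewrite ler_nat; lia.
rewrite ler_peMr// -[leLHS](_ : 1 `^ a = 1); last by rewrite powR1.
by apply: le_powR2r => //; exact: ltW.
Qed.

End half.

(** The sensors of [~: J] solve the same task for the positions [1 - u i]; reflecting their final
    positions back preserves distances. *)
Lemma min_movement_le {R : realType} (n h : nat) (a r : R) (J : {set 'I_n})
    (u : 'I_n -> R) :
  0 < a -> (0 < h)%N -> (forall i, 0 <= u i <= 1) ->
  (h <= #|J|)%N -> (h <= #|~: J|)%N -> 1 / (4 * h%:R) <= r ->
  (min_movement r a u <=
    (scarcity_cost a u J h + scarcity_cost a (fun i => 1 - u i) (~: J) h)%:E)%E.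
Proof.
move=> a0 h0 u01 hJ hJc hr.
have [b bcov bcost] := half_cover _ _ _ _ a0 h0 (fun i _ => u01 i) hJ.
have [|b' b'cov b'cost] := half_cover _ (fun i => 1 - u i) _ _ a0 h0 _ hJc.
  by move=> i _; have := u01 i; lra.
apply: (@le_trans _ _ (total_movement a u
    (fun i => if i \in J then b i else 1 - b' i))%:E); last first.
  rewrite lee_fin /total_movement (bigID (mem J))/=; apply: lerD.
    by apply: le_trans bcost; rewrite le_eqVlt; apply/orP; left; apply/eqP;
      apply: eq_bigr => i ->.
  apply: le_trans b'cost; rewrite le_eqVlt; apply/orP; left; apply/eqP.
  apply: eq_big => [i|i /negbTE ->]; first by rewrite inE.
  by rewrite -normrN; congr (`| _ | `^ _); lra.
apply: ereal_inf_lbound; exists (fun i => if i \in J then b i else 1 - b' i) => //.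
move=> x /=; rewrite in_itv/= => /andP[x0 x1].
have [xh|xh] := leP x (1 / 2).
  have [|i iJ /le_trans/(_ hr)] := bcov x; first by rewrite x0.
  rewrite ler_norml => xi; exists i => //=; rewrite iJ in_itv/=; lra.
have [|i iJ /le_trans/(_ hr)] := b'cov (1 - x); first by lra.
rewrite ler_norml => xi; exists i => //=; rewrite inE in iJ.
by rewrite (negbTE iJ) in_itv/=; lra.
Qed.

(** * Numerical estimates and the comparison of rates *)

Lemma powR_le_expR {R : realType} (b c x : R) : 0 < b -> 0 < c -> 0 <= x ->
  x `^ b <= (b / c) `^ b * expR (c * x).
Proof.
move=> b0 c0 x0.
have -> : expR (c * x) = expR (c * x / b) `^ b.
  by rewrite -expRM divfK ?gt_eqF.
have bc0 : 0 <= b / c by rewrite divr_ge0 ?ltW.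
(* Both sides are now powers of exponent [b], and the bases compare by
   [c * x / b <= expR (c * x / b)]. *)
rewrite -(powRM _ bc0 (expR_ge0 _)); apply: le_powR2r => //; first exact: ltW.
have {1}-> : x = b / c * (c * x / b) by field; rewrite ?gt_eqF.
by apply: (ler_wpM2l bc0); apply: le_trans (expR_ge1Dx _); lra.
Qed.

(** [expR (1 / 3) <= 1 / (1 - 1 / 3) = 3 / 2], so [e <= 27 / 8], which is below 9. *)
Lemma ln_ge1 {R : realType} (x : R) : 9 <= x -> 1 <= ln x.
Proof.
move=> x9; have x0 : 0 < x by lra.
rewrite -ler_expR lnK ?posrE//.
have : expR (1 / 3) <= 3 / 2 :> R.
  have := expR_ge1Dx (- (1 / 3) : R); rewrite expRN => e1.
  have e0 := expR_gt0 (1 / 3 : R).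
  have : expR (1 / 3) * (1 + - (1 / 3)) <= 1 :> R.
    by rewrite mulrC -ler_pdivlMr// [leRHS]mul1r.
  lra.
move=> e; have -> : 1 = 3%:R * (1 / 3) :> R by lra.
rewrite expRM_natl; apply: (@le_trans _ _ ((3 / 2) ^+ 3)); last by lra.
by apply: lerXn2r; rewrite ?nnegrE ?expR_ge0//; lra.
Qed.

Lemma two_thirds_le_ln3 {R : realType} : 2 / 3 <= ln 3 :> R.
Proof.
have := @le_ln1Dx R (- (2 / 3)).
have -> : 1 + - (2 / 3) = 3^-1 :> R by lra.
rewrite lnV ?posrE//; lra.
Qed.

(** Bootstrap on [x0 = 27 / 4 * (2 + a) * ln x0]: from [ln x0 >= 2 / 3] follows [x0 >= 9], hence
    [ln x0 >= 1], hence [x0 > 27 / 2]. *)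
Lemma fixed_point_gt13 {R : realType} (a x0 : R) : 0 < a -> 3 <= x0 ->
  x0 / (9 / 4 * (2 + a) * ln x0) = 3 -> 13 < x0.
Proof.
move=> a0 x3 xE.
have l3 : 2 / 3 <= ln x0.
  by apply: (le_trans two_thirds_le_ln3); rewrite ler_ln ?posrE//; lra.
have den0 : 0 < 9 / 4 * (2 + a) * ln x0 by rewrite !mulr_gt0//; lra.
have xE' : x0 = 3 * (9 / 4 * (2 + a) * ln x0).
  by rewrite -[in RHS]xE divfK// gt_eqF.
have x9 : 9 <= x0 by nra.
have l1 := ln_ge1 _ x9.
nra.
Qed.

(** Once [ln n] is replaced by its lower bound 1, both sides equal [n] to the power [1 - a]. *)
Lemma rate_ge {R : realType} (a : R) (n : nat) : 0 < a -> (13 < n)%N ->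
  n%:R * (n%:R^-1) `^ a <=
    1 / n%:R `^ (a / 2 - 1) * (ln n%:R / n%:R) `^ (a / 2).
Proof.
move=> a0 n13.
have n0 : 0 < n%:R :> R by rewrite ltr0n; lia.
have n0' : n%:R != 0 :> R by rewrite gt_eqF.
have l1 : 1 <= ln n%:R :> R by apply: ln_ge1; rewrite ler_nat; lia.
apply: (@le_trans _ _ (1 / n%:R `^ (a / 2 - 1) * (n%:R^-1) `^ (a / 2))).
  rewrite -(powR_inv1 (ltW n0)) -!powRrM div1r -powRN -powRD; last first.
    by apply/implyP.
  rewrite -{1}(powRr1 (ltW n0)) -powRD; last by apply/implyP.
  by rewrite le_eqVlt; apply/orP; left; apply/eqP; congr (_ `^ _); lra.
apply: ler_wpM2l; first by rewrite divr_ge0// powR_ge0.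
apply: le_powR2r; first lra.
  by rewrite invr_ge0 ltW.
by rewrite ler_peMl// invr_ge0 ltW.
Qed.

(** * Lower tail of the number of sensors in a window *)

Local Open Scope classical_set_scope.
Local Open Scope ring_scope.

Lemma measure_fin_bigcup_le {d : measure_display} {T : measurableType d}
    {R : realType} (mu : {measure set T -> \bar R}) {X : finType}
    (Q : {pred X}) (F : X -> set T) :
  (forall x, measurable (F x)) ->
  (mu (\bigcup_(x in [set` Q]) F x) <= \sum_(x in Q) mu (F x))%E.
Proof.
move=> mF; rewrite bigcup_pred; elim: (index_enum X) => [|x s IH].
  by rewrite !big_nil measure0.
rewrite !big_cons; case: ifP => // _.
apply: (@le_trans _ _ (mu (F x) + mu (\big[setU/set0]_(x <- s | x \in Q) F x))%E).
  apply: measureU2 => //; exact: bigsetU_measurable.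
exact: leeD2l.
Qed.

Section counting.
Context {d : measure_display} {T : measurableType d} {R : realType}.
Context (P : probability T R) {n : nat}.
Implicit Types (U : 'I_n -> {RV P >-> R}) (J : {set 'I_n}) (q : pred R).

Definition at_most U J q (l : nat) : set T :=
  [set w | (#|[set i in J | q (U i w)]%SET| <= l)%N].

(** These events split [at_most] according to the exact set [S] of sensors of [J] that land in [q];
    mutual independence makes the probability of each a product. *)
Let cell U J q (S : {set 'I_n}) : set T :=
  \bigcap_(i in [set` J])
    (U i @^-1` (if i \in S then [set x | q x] else ~` [set x | q x])).

Let measurable_cell U J q S :
  measurable [set x | q x] -> measurable (cell U J q S).
Proof.
move=> mq; apply: fin_bigcap_measurable => [|i _]; first exact: finite_finset.
rewrite -[_ @^-1` _]setTI; apply: measurable_funP => //.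
by case: ifP => // _; exact: measurableC.
Qed.

Let small J l := [pred S : {set 'I_n} | (S \subset J) && (#|S| <= l)%N].

Let at_mostE U J q l :
  at_most U J q l = \bigcup_(S in [set` small J l]) cell U J q S.
Proof.
apply/seteqP; split=> w; rewrite /at_most/=.
  move=> wl; exists [set i in J | q (U i w)]%SET.
    by rewrite /= inE/= wl andbT; apply/fintype.subsetP => i; rewrite inE => /andP[].
  move=> i /= iJ; rewrite inE (_ : i \in J)//=.
  by case: (boolP (q _)) => //= /negP.
move=> [S /= /andP[/fintype.subsetP SJ Sl] wS]; apply: leq_trans Sl.
apply: subset_leq_card; apply/fintype.subsetP => i; rewrite inE => /andP[iJ qi].
by have := wS i iJ; rewrite /=; case: ifP => // _ /(_ qi).
Qed.

Lemma measurable_at_most U J q l :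
  measurable [set x | q x] -> measurable (at_most U J q l).
Proof.
move=> mq; rewrite at_mostE; apply: fin_bigcup_measurable => [|S _].
  exact: finite_finset.
exact: measurable_cell.
Qed.

(* The events [cell S], over the subsets S of J of size at most l, have
   probability p^|S| (1 - p)^|J \ S|, which is at most 2^l (p/2)^|S| (1 - p)^|J \ S|;
   the sum of the latter over all S is the expansion of 2^l (p/2 + 1 - p)^|J|. *)
Lemma probability_at_most U J q l (p : R) :
  mutually_independent U -> measurable [set x | q x] -> 0 <= p <= 1 ->
  (forall i, P (U i @^-1` [set x | q x]) = p%:E) ->
  (P (at_most U J q l) <= (2 ^+ l * (1 - p / 2) ^+ #|J|)%:E)%E.
Proof.
move=> indep mq /andP[p0 p1] Pq.
have mU i A : measurable A -> measurable (U i @^-1` A).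
  by move=> mA; rewrite -[_ @^-1` _]setTI; exact: measurable_funP.
have PqC i : P (U i @^-1` (~` [set x | q x])) = (1 - p)%:E.
  by rewrite preimage_setC probability_setC; [rewrite Pq|exact: (mU i _ mq)].
(* The values 0 and 1 outside [J] extend the product to all indices: they kill every [S] not
   included in [J] and leave the other terms unchanged. *)
pose F i : R := if i \in J then p / 2 else 0.
pose G i : R := if i \in J then 1 - p else 1.
have FG S : 0 <= \prod_i (if i \in S then F i else G i).
  apply: prodr_ge0 => i _; rewrite /F /G.
  by case: ifP => _; case: ifP => _ //; lra.
rewrite at_mostE; have mcell S : measurable (cell U J q S) by exact: measurable_cell.
apply: (le_trans (measure_fin_bigcup_le P (small J l) _ mcell)).
have -> : (1 - p / 2) ^+ #|J| = \prod_i (F i + G i).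
  rewrite (bigID (mem J))/= [X in _ = _ * X]big1 ?mulr1; last first.
    by move=> i /negbTE iJ; rewrite /F /G iJ add0r.
  rewrite -prodr_const; apply: eq_bigr => i iJ; rewrite /F /G iJ; lra.
rewrite bigA_distr mulr_sumr.
apply: (@le_trans _ _ (\sum_(S in small J l)
   (2 ^+ l * \prod_i (if i \in S then F i else G i))%:E)%E); last first.
  rewrite sumEFin lee_fin [leRHS](bigID (mem (small J l)))/=.
  by rewrite lerDl sumr_ge0// => S _; rewrite mulr_ge0// exprn_ge0.
apply: lee_sum => S; rewrite inE/= => /andP[SJ Sl].
rewrite /cell indep; last by move=> i; case: ifP => // _; exact: measurableC.
rewrite (eq_bigr (fun i => (if i \in S then p else 1 - p)%:E)); last first.
  by move=> i _; case: ifP => _.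
rewrite prodEFin lee_fin.
have -> : \prod_(i in J) (if i \in S then p else 1 - p) =
    2 ^+ #|S| * \prod_i (if i \in S then F i else G i).
  rewrite [X in _ = _ * X](bigID (mem J))/= [X in _ = _ * (_ * X)]big1 ?mulr1; last first.
    move=> i /negbTE iJ; rewrite /F /G iJ; case: ifP => // iS.
    by rewrite (fintype.subsetP SJ _ iS) in iJ.
  rewrite -prodr_const big_mkcond/= [X in _ = X * _]big_mkcond/= .
  rewrite [X in _ = _ * X]big_mkcond/= -big_split/=; apply: eq_bigr => i _.
  rewrite /F /G; case: (boolP (i \in J)) => iJ; case: ifP => iS; rewrite ?mulr1 ?mul1r//.
    lra.
  by rewrite (fintype.subsetP SJ _ iS) in iJ.
by apply: ler_pM => //; apply: ler_weXn2l => //; lra.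
Qed.

End counting.

(** * Geometric sums and the decay rate per cell *)

Lemma sum_geometric_le {R : realType} (x : R) (m : nat) : 0 <= x < 1 ->
  \sum_(i < m) x ^+ i <= (1 - x)^-1.
Proof.
move=> /andP[x0 x1]; rewrite -[leRHS]mulr1 mulrC ler_pdivlMr ?subr_gt0//.
have := subrX1 x m; have := exprn_ge0 m x0; nra.
Qed.

(* The mean of 2^-N for N Poisson of parameter 3/2, which is the least expected number
   of sensors of one half in one cell. *)
Definition decay (R : realType) : R := expR (- (3 / 4)).

Lemma decay_gt0 (R : realType) : 0 < decay R.
Proof. exact: expR_gt0. Qed.

(** [expR (3 / 4) >= (1 + 1 / 8) ^+ 6 > 2]. This lets the decay beat the factor [2 ^+ l] of the
    counting bound when summing over [l]. *)
Lemma decay_lt_half (R : realType) : 2 * decay R < 1.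
Proof.
rewrite /decay expRN ltr_pdivrMr ?expR_gt0// mul1r.
have -> : 3 / 4 = 6%:R * (1 / 8) :> R by lra.
rewrite expRM_natl; apply: (@lt_le_trans _ _ ((1 + 1 / 8) ^+ 6)); first by lra.
by apply: lerXn2r; rewrite ?nnegrE ?expR_ge0 ?expR_ge1Dx//; lra.
Qed.

(** * Uniform positions and their reflections *)

Section uniform.
Context {d : measure_display} {T : measurableType d} {R : realType}.
Context (P : probability T R).
Implicit Type X : {RV P >-> R}.

Lemma uniform01_itv X (i : interval R) : uniform01 X -> [set` i] `<=` `[0, 1] ->
  P (X @^-1` [set` i]) = lebesgue_measure [set` i].
Proof.
move=> uX i01; transitivity (uniform_prob (@ltr01 R) [set` i]).
  exact: (uX _ (measurable_itv i)).
rewrite /uniform_prob.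
rewrite (eq_integral (cst 1%E)) ?integral_cst ?mul1e//.
move=> x; rewrite inE => /i01/=; rewrite in_itv/= /uniform_pdf => ->.
by rewrite subr0 invr1.
Qed.

(** The property shared by a uniform position and its reflection, so that one scarcity estimate
    serves both halves. *)
Definition uniform_windows (phi : R -> R) X : Prop :=
  forall x y, 0 <= x -> x <= y -> y <= 1 ->
    P (X @^-1` [set t | x <= phi t < y]) = (y - x)%:E.

Lemma uniform_windows_id X : uniform01 X -> uniform_windows id X.
Proof.
move=> uX x y x0 xy y1.
have -> : [set t | x <= id t < y] = `[x, y[%classic.
  by apply/seteqP; split=> t /=; rewrite in_itv.
rewrite uniform01_itv//; last first.
  by move=> t /=; rewrite !in_itv/= => /andP[? ?]; apply/andP; split; lra.
rewrite lebesgue_measure_itv/= lte_fin; case: ltP => // yx.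
have -> : x = y by lra.
by rewrite subrr.
Qed.

Lemma uniform_windows_onem X : uniform01 X -> uniform_windows (fun t => 1 - t) X.
Proof.
move=> uX x y x0 xy y1.
have -> : [set t : R | x <= 1 - t < y] = `](1 - y), (1 - x)]%classic.
  by apply/seteqP; split=> t /=; rewrite in_itv/=; lra.
rewrite uniform01_itv//; last first.
  by move=> t /=; rewrite !in_itv/= => /andP[? ?]; apply/andP; split; lra.
rewrite lebesgue_measure_itv/= lte_fin; case: ltP => yx.
  by rewrite -EFinB; congr EFin; lra.
have -> : x = y by lra.
by rewrite subrr.
Qed.

Lemma uniform01_out X : uniform01 X -> P (~` (X @^-1` `[0, 1])) = 0%E.
Proof.
move=> uX; rewrite probability_setC; last first.
  by rewrite -[_ @^-1` _]setTI; exact: measurable_funP.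
by rewrite uniform01_itv// lebesgue_measure_itv/= lte_fin ltr01 sube0 subee.
Qed.

End uniform.

(** * Probability that a cell is scarce *)

Section scarcity.
Context {d : measure_display} {T : measurableType d} {R : realType}.
Context (P : probability T R) {n : nat}.
Implicit Types (U : 'I_n -> {RV P >-> R}) (J : {set 'I_n}).

Definition scarce U (phi : R -> R) J (h j k : nat) : set T :=
  [set w | ~~ plentiful (fun i => phi (U i w)) J (grid h) j k].

Let win (phi : R -> R) (h j k l : nat) : pred R :=
  fun t => grid h (j - l) <= phi t < grid h (j + k).

Let scarceE U phi J h j k : scarce U phi J h j k =
  \bigcup_(l in [set` [pred l : 'I_j.+1 | true]]) at_most P U J (win phi h j k l) l.
Proof.
apply/seteqP; split => w; rewrite /scarce /at_most/=.
  by move=> /forallPn[l]; rewrite -leqNgt => lw; exists l.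
by move=> [l _ lw]; apply/forallPn; exists l; rewrite -leqNgt.
Qed.

Let measurable_win phi h j k l : measurable_fun setT phi ->
  measurable [set t | win phi h j k l t].
Proof.
move=> mphi.
have -> : [set t | win phi h j k l t] = phi @^-1` `[grid h (j - l), grid h (j + k)[%classic.
  by apply/seteqP; split=> t /=; rewrite in_itv.
by rewrite -[_ @^-1` _]setTI; apply: mphi.
Qed.

Lemma measurable_scarce U phi J h j k : measurable_fun setT phi ->
  measurable (scarce U phi J h j k).
Proof.
move=> mphi; rewrite scarceE; apply: fin_bigcup_measurable => [|l _].
  exact: finite_finset.
by apply: measurable_at_most; exact: measurable_win.
Qed.

(** Union bound over [l]: with [p = (l + k) / (2 * h)] and at least [3 * h] sensors,
    [(1 - p / 2) ^+ #|J|] is at most [decay R ^+ (l + k)]. The remaining series in [l] has ratio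
    [2 * decay R]. *)
Lemma probability_scarce U phi J h j k :
  mutually_independent U -> measurable_fun setT phi ->
  (forall i, uniform_windows P phi (U i)) ->
  (0 < h)%N -> (j + k <= 2 * h)%N -> (3 * h <= #|J|)%N ->
  (P (scarce U phi J h j k) <=
    ((1 - 2 * decay R)^-1 * decay R ^+ k)%:E)%E.
Proof.
move=> indep mphi uU h0 jk hJ.
have hR : 0 < h%:R :> R by rewrite ltr0n.
rewrite scarceE.
apply: (le_trans (measure_fin_bigcup_le P _ _ _)).
  by move=> l; apply: measurable_at_most; exact: measurable_win.
apply: (@le_trans _ _ (\sum_(l < j.+1) ((2 * decay R) ^+ l * decay R ^+ k)%:E)%E).
  apply: lee_sum => l _.
  have lj : (l <= j)%N by rewrite -ltnS.
  pose p : R := (l + k)%:R / (2 * h%:R).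
  have gridB : grid h (j + k) - grid h (j - l) = p.
    by rewrite /p /grid !natrD natrB//; field; rewrite gt_eqF.
  have p0 : 0 <= p by rewrite divr_ge0// mulr_ge0// ltW.
  have g0 : 0 <= grid h (j - l) :> R by rewrite divr_ge0// mulr_ge0// ltW.
  (* The bound on [j + k] keeps the window inside [0, 1], where its probability is its length. *)
  have g1 : grid h (j + k) <= 1 :> R.
    by rewrite ler_pdivrMr ?mulr_gt0// mul1r -natrM ler_nat.
  have := @probability_at_most _ _ _ P _ U J (win phi h j k l) l p indep
    (measurable_win _ _ _ _ _ mphi).
  move=> /(_ _ _)/le_trans; apply.
  - by apply/andP; split => //; lra.
  - by move=> i; rewrite -gridB; apply: uU => //; lra.
  rewrite lee_fin exprMn -[leRHS]mulrA; apply: ler_wpM2l; first exact: exprn_ge0.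
  rewrite -exprD.
  rewrite /decay -expRM_natl.
  apply: (@le_trans _ _ (expR (- (p / 2)) ^+ #|J|)).
    apply: lerXn2r; rewrite ?nnegrE ?expR_ge0//; last exact: expR_ge1Dx.
    lra.
  rewrite -expRM_natl ler_expR.
  have : 3 * h%:R <= #|J|%:R :> R by rewrite -natrM ler_nat.
  move=> hJR; have -> : (l + k)%:R = 2 * h%:R * p by rewrite /p; field; rewrite gt_eqF.
  nra.
rewrite sumEFin lee_fin -mulr_suml.
apply: ler_wpM2r; first by rewrite exprn_ge0// ltW// decay_gt0.
apply: sum_geometric_le; rewrite decay_lt_half andbT.
by rewrite mulr_ge0// ltW// decay_gt0.
Qed.

End scarcity.

(* Unlike in the library's [ge0_le_integral], f need not be measurable. *)
Lemma le_integral_nonmeasurable {d : measure_display} {T : measurableType d}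
    {R : realType} (mu : {measure set T -> \bar R}) (f g : T -> \bar R) :
  (forall x, 0 <= f x)%E -> (forall x, f x <= g x)%E ->
  (\int[mu]_x f x <= \int[mu]_x g x)%E.
Proof.
move=> f0 fg; have g0 x : (0 <= g x)%E by exact: le_trans (fg x).
rewrite !ge0_integralTE//; apply: ge_ereal_sup => _ [h /= hf <-].
by apply: ereal_sup_ubound; exists h => //= x; exact: le_trans (fg x).
Qed.

(** * Expectation of the scarcity cost *)

Lemma measurable_indic_sum {d : measure_display} {T : measurableType d}
    {R : realType} {X : finType} (c : X -> R) (e : X -> T -> bool) (Q : pred X) :
  (forall x, measurable [set w | e x w]) ->
  measurable_fun setT (EFin \o (fun w => \sum_(x | Q x) c x * (e x w)%:R : R)).
Proof.
move=> me; apply/measurable_EFinP.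
have -> : (fun w => \sum_(x | Q x) c x * (e x w)%:R) =
    (fun w => \sum_(x <- [seq x <- index_enum X | Q x]) c x * \1_[set w | e x w] w).
  apply/funext => w; rewrite big_filter; apply: eq_bigr => x _.
  by rewrite indicE /= mem_setE.
by apply: measurable_sum => x; exact: measurable_funM.
Qed.

Lemma integral_indic_sum {d : measure_display} {T : measurableType d}
    {R : realType} (mu : {measure set T -> \bar R}) {X : finType} (c : X -> R)
    (e : X -> T -> bool) (Q : pred X) :
  (forall x, 0 <= c x) -> (forall x, measurable [set w | e x w]) ->
  (\int[mu]_w (\sum_(x | Q x) c x * (e x w)%:R)%:E =
    \sum_(x | Q x) (c x)%:E * mu [set w | e x w])%E.
Proof.
move=> c0 me.
rewrite -big_filter (eq_integral (fun w =>
  (\sum_(x <- [seq x <- index_enum X | Q x]) (c x)%:E * (\1_[set w | e x w] w)%:E)%E)); last first.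
  move=> w _; rewrite -sumEFin -big_filter; apply: eq_bigr => x _.
  by rewrite EFinM indicE /= mem_setE.
rewrite ge0_integral_sum//.
- apply: eq_bigr => x _; rewrite ge0_integralZl_EFin//.
  + by rewrite integral_indic// setIT.
  + by apply/measurable_EFinP; exact: measurable_indic.
- move=> x; apply: measurable_funeM; apply/measurable_EFinP.
  exact: measurable_indic.
- by move=> x w _; rewrite mule_ge0// lee_fin.
Qed.

Section expected_scarcity.
Context {d : measure_display} {T : measurableType d} {R : realType}.
Context (P : probability T R) {n : nat}.
Implicit Types (U : 'I_n -> {RV P >-> R}) (J : {set 'I_n}).

Let scarcity_costE (a : R) U phi J h w :
  scarcity_cost a (fun i => phi (U i w)) J h =
  \sum_(x : 'I_h * 'I_(2 * h).+1 | (x.1 + x.2 <= 2 * h)%N)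
    scarcity_weight a h x.2 *
    (~~ plentiful (fun i => phi (U i w)) J (grid h) x.1 x.2)%:R.
Proof. by rewrite /scarcity_cost pair_big_dep. Qed.

Lemma measurable_scarcity_cost (a : R) U phi J h : measurable_fun setT phi ->
  measurable_fun setT
    (EFin \o (fun w => scarcity_cost a (fun i => phi (U i w)) J h)).
Proof.
move=> mphi; under eq_fun do rewrite scarcity_costE.
by apply: measurable_indic_sum => x; exact: measurable_scarce.
Qed.

(* The polynomial factor (k+1)^(a+1) is absorbed by expR ((k+1)/2), which leaves
   expR (1/2 - k/4) from decay ^ k. *)
Definition scarcity_constant (a : R) : R :=
  (1 - 2 * decay R)^-1 * (2 `^ a * (4 * (4 * a) `^ a * expR (1 / 2))) *
  (1 - expR (- (1 / 4)))^-1.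

Lemma weight_decay_le (a : R) h k : 0 < a -> (0 < h)%N ->
  scarcity_weight a h k * decay R ^+ k <=
  2 `^ a * (4 * (4 * a) `^ a * expR (1 / 2)) * (2 * h%:R)^-1 `^ a *
  expR (- (1 / 4)) ^+ k.
Proof.
move=> a0 h0; rewrite /scarcity_weight.
have kR : 0 <= k.+1%:R :> R by [].
have hi : 0 <= (2 * h%:R)^-1 :> R by rewrite invr_ge0 mulr_ge0.
rewrite (powRM _ kR hi).
(* The factors [k + 1] and its power [a] each use up one [expR ((k + 1) / 4)]. *)
have k1 : k.+1%:R <= 4 * expR (1 / 4 * k.+1%:R) :> R.
  by have := expR_ge1Dx (1 / 4 * k.+1%:R : R); lra.
have k2 : k.+1%:R `^ a <= (4 * a) `^ a * expR (1 / 4 * k.+1%:R) :> R.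
  apply: (le_trans (@powR_le_expR _ a (1 / 4) _ a0 _ _)) => //.
  by rewrite (_ : a / (1 / 4) = 4 * a)//; field.
have k3 : expR (1 / 4 * k.+1%:R) * expR (1 / 4 * k.+1%:R) * decay R ^+ k =
    expR (1 / 2) * expR (- (1 / 4)) ^+ k.
  rewrite /decay -!expRM_natl -!expRD; congr expR; rewrite -(natr1 k). lra.
have k4 : k.+1%:R * k.+1%:R `^ a * decay R ^+ k <=
    4 * (4 * a) `^ a * expR (1 / 2) * expR (- (1 / 4)) ^+ k.
  rewrite -[leRHS]mulrA -k3.
  have -> : 4 * (4 * a) `^ a * (expR (1 / 4 * k.+1%:R) * expR (1 / 4 * k.+1%:R) * decay R ^+ k) =
      4 * expR (1 / 4 * k.+1%:R) * ((4 * a) `^ a * expR (1 / 4 * k.+1%:R)) * decay R ^+ k by ring.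
  apply: ler_wpM2r; first by rewrite exprn_ge0// ltW// decay_gt0.
  by apply: ler_pM => //; exact: powR_ge0.
set A := 2 `^ a; set B := (2 * h%:R)^-1 `^ a.
have -> : A * (k.+1%:R * (k.+1%:R `^ a * B)) * decay R ^+ k =
  A * B * (k.+1%:R * k.+1%:R `^ a * decay R ^+ k) by ring.
have -> : A * (4 * (4 * a) `^ a * expR (1 / 2)) * B * expR (- (1 / 4)) ^+ k =
  A * B * (4 * (4 * a) `^ a * expR (1 / 2) * expR (- (1 / 4)) ^+ k) by ring.
by apply: ler_wpM2l => //; rewrite mulr_ge0// powR_ge0.
Qed.

(** By linearity, each of the [h] cells contributes at most a geometric series in [k] of ratio
    [expR (- (1 / 4))]. *)
Lemma expected_scarcity_cost (a : R) U phi J h : 0 < a ->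
  mutually_independent U -> measurable_fun setT phi ->
  (forall i, uniform_windows P phi (U i)) ->
  (0 < h)%N -> (3 * h <= #|J|)%N ->
  (\int[P]_w (scarcity_cost a (fun i => phi (U i w)) J h)%:E <=
    (scarcity_constant a * (h%:R * (2 * h%:R)^-1 `^ a))%:E)%E.
Proof.
move=> a0 indep mphi uU h0 hJ.
under eq_integral do rewrite scarcity_costE.
rewrite integral_indic_sum; last 2 first.
- by move=> x; exact: scarcity_weight_ge0.
- by move=> x; exact: measurable_scarce.
set K := (1 - 2 * decay R)^-1.
have K0 : 0 <= K by rewrite invr_ge0 subr_ge0 ltW// decay_lt_half.
set M := 2 `^ a * (4 * (4 * a) `^ a * expR (1 / 2)) * (2 * h%:R)^-1 `^ a.
have M0 : 0 <= M by rewrite !mulr_ge0 ?powR_ge0 ?expR_ge0.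
pose F k := K * (M * expR (- (1 / 4)) ^+ k).
have F0 k : 0 <= F k by rewrite /F mulr_ge0// mulr_ge0// exprn_ge0// expR_ge0.
apply: (@le_trans _ _ (\sum_(x : 'I_h * 'I_(2 * h).+1 | (x.1 + x.2 <= 2 * h)%N)
    (F x.2)%:E)%E).
  apply: lee_sum => -[j k] /= jk.
  apply: (@le_trans _ _ ((scarcity_weight a h k)%:E * (K * decay R ^+ k)%:E)%E).
    apply: lee_wpmul2l; first by rewrite lee_fin scarcity_weight_ge0.
    exact: probability_scarce.
  rewrite -EFinM lee_fin mulrCA /F; apply: ler_wpM2l => //.
  exact: weight_decay_le.
rewrite sumEFin lee_fin.
(* Over all pairs, the sum becomes [h] equal geometric sums. *)
apply: (@le_trans _ _ (\sum_(x : 'I_h * 'I_(2 * h).+1) F x.2)).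
  by rewrite [leRHS](bigID (fun x : 'I_h * 'I_(2 * h).+1 => (x.1 + x.2 <= 2 * h)%N))/= lerDl sumr_ge0.
rewrite -(pair_bigA _ (fun (j : 'I_h) (k : 'I_(2 * h).+1) => F k))/=.
rewrite sumr_const card_ord -!mulr_sumr -[leLHS]mulr_natl.
have -> : scarcity_constant a * (h%:R * (2 * h%:R)^-1 `^ a) =
  h%:R * (K * (M * (1 - expR (- (1 / 4)))^-1)).
  by rewrite /scarcity_constant -/K /M; ring.
do 3 (apply: ler_wpM2l => //).
apply: sum_geometric_le; rewrite expR_ge0/= expR_lt1; lra.
Qed.

End expected_scarcity.

(** * Choice of the cells and assembly of the two halves *)

Theorem theorem8 (R : realType) (a f x0 : R) (ha : 0 < a) (hf : 6 < f)
    (hx0 : 3 <= x0) (hx0E : x0 / (9 / 4 * (2 + a) * ln x0) = 3) :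
  exists C : R, forall n : nat, Num.ceil x0 <= n%:Z ->
    forall (d : measure_display) (T : measurableType d) (P : probability T R)
      (U : 'I_n -> {RV P >-> R}),
      mutually_independent U -> (forall i : 'I_n, uniform01 (U i)) ->
      (expected_movement (f / (2 * n%:R)) a U <=
        (C * (1 / n%:R `^ (a / 2 - 1) * (ln n%:R / n%:R) `^ (a / 2)))%:E)%E.
Proof.
(* The factor 2 counts the halves; the power of 6 comes from [(2 * h)^-1 <= 6 / n]. *)
exists (2 * scarcity_constant a * 6 `^ a) => n nx0 d T P U indep unif.
have n13 : (13 < n)%N.
  have : x0 <= n%:R.
    by apply: (le_trans (ceil_ge x0)); rewrite -[leRHS]/(n%:Z%:~R) ler_int.
  have := fixed_point_gt13 _ _ ha hx0 hx0E; rewrite -(ltr_nat R); lra.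
(* Rounding up gives [n <= 12 * h], for the radius and the cost, while [3 * h <= n./2] still leaves
   each half enough sensors. *)
pose h := ((n + 11) %/ 12)%N.
have h0 : (0 < h)%N by rewrite /h; lia.
have hn : (n <= 12 * h)%N by rewrite /h; lia.
have h3 : (3 * h <= n./2)%N by rewrite /h; lia.
have hR : 0 < h%:R :> R by rewrite ltr0n.
have nR : 0 < n%:R :> R by rewrite ltr0n; lia.
have hnR : n%:R <= 12 * h%:R :> R by rewrite -natrM ler_nat.
pose J : {set 'I_n} := [set i : 'I_n | (i < n./2)%N]%SET.
have cJ : #|J| = n./2.
  rewrite -sum1dep_card -(big_ord_widen n (fun=> 1%N)) ?sum1_card ?card_ord//.
  lia.
have cJc : (n./2 <= #|~: J|)%N.
  by have := cardsC J; rewrite cJ card_ord; lia.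
pose out i := (~` (U i @^-1` `[0, 1]))%classic.
pose N := (\bigcup_(i in [set` [pred i : 'I_n | true]]) out i)%classic.
have mout i : measurable (out i).
  by apply: measurableC; rewrite -[X in measurable X]setTI; exact: measurable_funP.
have mN : measurable N by apply: fin_bigcup_measurable => //; exact: finite_finset.
have PN : P N = 0%E.
  apply/eqP; rewrite eq_le measure_ge0 andbT.
  apply: (le_trans (measure_fin_bigcup_le P _ _ mout)).
  by rewrite big1// => i _; exact: uniform01_out.
pose W1 w := (scarcity_cost a (fun i => U i w) J h)%:E.
pose W2 w := (scarcity_cost a (fun i => 1 - U i w) (~: J) h)%:E.
have W1_ge0 w : (0 <= W1 w)%E.
  rewrite lee_fin; do 2 (apply: sumr_ge0 => ? _).
  by rewrite mulr_ge0 ?scarcity_weight_ge0.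
have W2_ge0 w : (0 <= W2 w)%E.
  rewrite lee_fin; do 2 (apply: sumr_ge0 => ? _).
  by rewrite mulr_ge0 ?scarcity_weight_ge0.
have monem : measurable_fun setT (fun t : R => 1 - t).
  by apply: measurable_funB => //; exact: measurable_cst.
have mW1 : measurable_fun setT W1.
  exact: (@measurable_scarcity_cost _ _ _ P n a U id J h).
have mW2 : measurable_fun setT W2.
  exact: (@measurable_scarcity_cost _ _ _ P n a U (fun t => 1 - t) (~: J) h).
(* The deterministic bound needs positions in [0, 1], which holds only almost surely;
   the null term Z takes care of the exceptional event N. *)
pose Z : T -> \bar R := ((cst +oo%E) \_ N)%classic.
have Z_ge0 w : (0 <= Z w)%E.
  by rewrite /Z patchE; case: ifP => //= _; rewrite leey.
have mZ : measurable_fun setT Z.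
  by apply/(measurable_restrictT _ _).1 => //; exact: measurable_cst.
have IZ : (\int[P]_w Z w = 0)%E.
  transitivity (\int[P]_(w in N) cst +oo w)%E; first by rewrite [RHS]integral_mkcond.
  by rewrite integral_cst// [X in (_ * X)%E]PN mule0.
apply: (@le_trans _ _ (\int[P]_w (W1 w + W2 w + Z w))%E).
  apply: le_integral_nonmeasurable => w.
    apply: le_ereal_inf_tmp => _ [b _ <-]; rewrite lee_fin.
    by apply: sumr_ge0 => i _; exact: powR_ge0.
  have [wN|wN] := pselect (N w).
    by rewrite /Z patchE mem_set// addey ?leey// gt_eqF// (lt_le_trans (ltNy0 _))// adde_ge0.
  rewrite /Z patchE memNset// adde0 -EFinD; apply: min_movement_le => //.
  - move=> i; apply: contrapT => ui; apply: wN; exists i => //.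
  - by rewrite cJ; lia.
  - by lia.
  (* Here [f > 6] enters: [1 / (4 * h) <= 3 / n < f / (2 * n)]. *)
  - rewrite ler_pdivrMr ?mulr_gt0//.
    have -> : f / (2 * n%:R) * (4 * h%:R) = 2 * f * h%:R / n%:R.
      by field; rewrite gt_eqF.
    by rewrite ler_pdivlMr// mul1r; nra.
rewrite ge0_integralD//; last 2 first.
- by move=> w _; rewrite adde_ge0.
- exact: emeasurable_funD.
rewrite IZ adde0 ge0_integralD//.
set B := (scarcity_constant a * (h%:R * (2 * h%:R)^-1 `^ a)).
have I1 : (\int[P]_w W1 w <= B%:E)%E.
  apply: (@expected_scarcity_cost _ _ _ P n a U id J h) => //.
    by move=> i; exact: uniform_windows_id.
  by rewrite cJ.
have I2 : (\int[P]_w W2 w <= B%:E)%E.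
  apply: (@expected_scarcity_cost _ _ _ P n a U (fun t => 1 - t)) => //.
    by move=> i; exact: uniform_windows_onem.
  exact: leq_trans cJc.
apply: (le_trans (leeD I1 I2)); rewrite -EFinD lee_fin.
have S0 : 0 <= scarcity_constant a :> R.
  by rewrite !mulr_ge0 ?powR_ge0 ?expR_ge0 ?invr_ge0 ?subr_ge0 ?(ltW (decay_lt_half R))//.
have hrate : h%:R * (2 * h%:R)^-1 `^ a <= 6 `^ a * (n%:R * n%:R^-1 `^ a) :> R.
  have -> : 6 `^ a * (n%:R * n%:R^-1 `^ a) = n%:R * (6 / n%:R) `^ a :> R.
    by rewrite powRM// ?invr_ge0 ?ltW//; ring.
  apply: ler_pM => //.
    by rewrite ler_nat /h; lia.
  apply: le_powR2r; first exact: ltW.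
    by rewrite invr_ge0 mulr_ge0.
  by rewrite ler_pdivlMr// mulrC ler_pdivrMr ?mulr_gt0//; lra.
rewrite /B -mulr2n -[leLHS]mulr_natl [leLHS]mulrA -[leRHS]mulrA.
apply: ler_wpM2l; first by rewrite mulr_ge0.
apply: (le_trans hrate); apply: ler_wpM2l; first exact: powR_ge0.
exact: rate_ge.
Qed.
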